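(* Let $\mathbf{k}$ be an algebraically closed field of characteristic $0$, let $S$ be a nonempty set, and let $L$ be a finite dimensional solvable Lie-like algebra$^{2-nd}$ over $\mathbf{k}$ induced by $S$. If $(V,\{f_k\},\{g_k\}_{k\in S})$ is a finite dimensional nonzero ordinary $L$-module, then there exist linear functionals $\phi_k,\psi_k: L\to\mathbf{k}$ for $k\in S$ and a nonzero vector $v\in V$ such that $$f_k(z)(v)=\phi_k(z)v,\qquad g_k(z)(v)=\psi_k(z)v\qquad\text{for all } z\in L \text{ and } k\in S.$$ Moreover, either $\psi_k=0$ for all $k\in S$, or $\phi_k=\psi_k$ for all $k\in S$.
   Context: All vector spaces are over $\mathbf{k}$. Lie-like algebra$^{2-nd}$: Let $S$ be a nonempty set. A vector space $L$ is called a Lie-like algebra$^{2-nd}$ induced by $S$ if it is equipped with a family of bilinear operations $\langle\,,\,\rangle_k: L\times L\to L$, $k\in S$, such that for all $x,y,z\in L$ and $h,k\in S$, $$\langle\langle x,y\rangle_k,z\rangle_h=\langle x,\langle y,z\rangle_h\rangle_k+\langle\langle x,z\rangle_h,y\rangle_k\quad\text{and}\quad \langle\langle x,y\rangle_k,z\rangle_h=\langle\langle x,y\rangle_h,z\rangle_k.$$ Ordinary module: an ordinary $L$-module $(V,\{f_k\},\{g_k\}_{k\in S})$ is a vector space $V$ with linear maps $f_k,g_k: L\to \mathrm{End}(V)$, $k\in S$, such that for all $x,y\in L$ and $h,k\in S$, $$f_h(\langle x,y\rangle_k)=[f_h(x),f_k(y)],\qquad g_h(\langle x,y\rangle_k)=[g_h(x),f_k(y)],$$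 $$g_k(x)g_h(y)=g_h(x)f_k(y)=g_k(x)f_h(y),$$ $$f_k(x)f_h(y)=f_h(x)f_k(y),\qquad f_k(x)g_h(y)=f_h(x)g_k(y),$$ where $[X,Y]=XY-YX$ in $\mathrm{End}(V)$. Solvable: $L$ is solvable if $\mathcal{D}^nL=0$ for some positive integer $n$, where $\mathcal{D}^1L:=L$ and $\mathcal{D}^{n+1}L:=\sum_{k\in S}\langle\mathcal{D}^nL,\mathcal{D}^nL\rangle_k$ for $n\ge 1$, with $\langle A,B\rangle_k$ denoting the linear span of all $\langle a,b\rangle_k$, $a\in A$, $b\in B$. *)

(* Defs.v *)
From HB Require Import structures.
From mathcomp Require Export all_boot all_order all_algebra.
Set Implicit Arguments.
Unset Strict Implicit.
Unset Printing Implicit Defensive.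
Import GRing.Theory.
Local Open Scope ring_scope.

(* Subspaces of L are represented by predicates L -> Prop, because the sum over
   the possibly infinite index set S below is not a {vspace L} by computation. *)

Definition lin_span (k : fieldType) (L : vectType k) (P : L -> Prop) : L -> Prop :=
  fun x => exists s : seq L, (forall y, y \in s -> P y) /\ x \in <<s>>%VS.

(* Internal sum of a family of subspaces: all finite sums of their elements. *)
Definition subspace_sum (k : fieldType) (L : vectType k) (I : Type)
    (P : I -> L -> Prop) : L -> Prop :=
  fun x => exists s : seq L,
    (forall y, y \in s -> exists i, P i y) /\ x = \sum_(y <- s) y.

Definition lie_like2 (k : fieldType) (S : Type) (L : vectType k)
    (br : S -> {bilinear L -> L -> L}) : Prop :=
  forall (x y z : L) (h i : S),
    br h (br i x y) z = br i x (br h y z) + br i (br h x z) y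
    /\ br h (br i x y) z = br i (br h x y) z.

Definition bracket_span (k : fieldType) (S : Type) (L : vectType k)
    (br : S -> {bilinear L -> L -> L}) (i : S) (A B : L -> Prop) : L -> Prop :=
  lin_span (fun x => exists a b : L, [/\ A a, B b & x = br i a b]).

(* The series starts at index 1 (index 0 also returns L). *)
Definition derived (k : fieldType) (S : Type) (L : vectType k)
    (br : S -> {bilinear L -> L -> L}) (n : nat) : L -> Prop :=
  iter n.-1 (fun D => subspace_sum (fun i => bracket_span br i D D))
    (fun=> True).

Definition lie_like2_solvable (k : fieldType) (S : Type) (L : vectType k)
    (br : S -> {bilinear L -> L -> L}) : Prop :=
  exists2 n : nat, (0 < n)%N & forall x : L, derived br n x -> x = 0.

Definition lfun_comm (k : fieldType) (V : vectType k) (X Y : 'End(V)) : 'End(V) :=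
  (X \o Y)%VF - (Y \o X)%VF.

Definition ordinary_module (k : fieldType) (S : Type) (L V : vectType k)
    (br : S -> {bilinear L -> L -> L})
    (f g : S -> {linear L -> 'End(V)}) : Prop :=
  forall (x y : L) (h i : S),
    [/\ f h (br i x y) = lfun_comm (f h x) (f i y)
          /\ g h (br i x y) = lfun_comm (g h x) (f i y),
        (g i x \o g h y = g h x \o f i y)%VF,
        (g h x \o f i y = g i x \o f h y)%VF,
        (f i x \o f h y = f h x \o f i y)%VF
      & (f i x \o g h y = f h x \o g i y)%VF].

(* Main.v *)
Require Import Defs.
From HB Require Import structures.
From Stdlib Require Import Classical.
From mathcomp Require Import all_boot all_order all_algebra.
Import GRing.Theory.
Local Open Scope ring_scope.

(** The maps [f_k(x)] span a solvable Lie algebra of endomorphisms, so Lie's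
    theorem gives a common eigenvector in every nonzero [f]-invariant subspace.
    Let [K] be the common kernel of all the [g_k(x)]. The identities
    [g_k(x) g_h(y) = g_h(x) f_k(y) = g_k(x) f_h(y)] show that [K] is
    [f]-invariant and that [g_h(y) - f_h(y)] takes its values in [K]. If [K] is
    nonzero, an eigenvector of [f] in [K] has [psi = 0]; otherwise [g = f]. *)

(** * Commutators and eigenvectors in an invariant subspace *)

Lemma lfun_commE (k : fieldType) (V : vectType k) (X Y : 'End(V)) (v : V) :
  lfun_comm X Y v = X (Y v) - Y (X v).
Proof. by rewrite /lfun_comm add_lfunE opp_lfunE !comp_lfunE. Qed.

Lemma lfun_eigenvector (k : closedFieldType) (V : vectType k) (X : 'End(V))
    (W : {vspace V}) :
  W != 0%VS -> (forall w, w \in W -> X w \in W) ->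
  exists2 u, (u \in W) && (u != 0) & X u \in <[u]>%VS.
Proof.
move=> W0 XW; set b := vbasis W.
have freeb : free b := basis_free (vbasisP W).
(* The rows of [A] hold the coordinates of the images of the basis, so [X] acts on coordinate rows
   by right multiplication. This matches the row eigenvectors of [eigenvalueP]. *)
pose A : 'M_(\dim W) := \matrix_(i, j) coord b j (X b`_i).
have [a ra] : exists a, root (char_poly A) a.
  by apply/closed_rootP; rewrite size_char_poly eqSS dimv_eq0.
move: ra; rewrite -eigenvalue_root_char => /eigenvalueP [r rA r0].
pose u := \sum_i r 0 i *: b`_i.
have bW (i : 'I_(\dim W)) : b`_i \in W.
  by apply: vbasis_mem; rewrite mem_nth ?size_tuple.
exists u.
  apply/andP; split; first by apply: memv_suml => i _; apply: memvZ.
  apply: contra r0 => /eqP u0; apply/eqP/rowP => i; rewrite mxE.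
  exact: (elimT freeP freeb (fun i => r 0 i) u0).
apply/vlineP; exists a.
rewrite /u linear_sum scaler_sumr /=.
have -> : \sum_i X (r 0 i *: b`_i) = \sum_j (r *m A) 0 j *: b`_j.
  under eq_bigr => i _.
    rewrite linearZ /= (coord_vbasis (XW _ (bW i))) scaler_sumr.
    under eq_bigr => j _ do rewrite scalerA.
  over.
  rewrite exchange_big /=; apply: eq_bigr => j _.
  rewrite -scaler_suml mxE; congr (_ *: _).
  by apply: eq_bigr => i _; rewrite mxE.
by rewrite rA; apply: eq_bigr => i _; rewrite mxE scalerA.
Qed.

(** * Krylov subspaces and vanishing of weights on commutators *)

Section Krylov.

Variables (k : fieldType) (V : vectType k) (X : 'End(V)) (w : V).

Fixpoint krylov (i : nat) : {vspace V} :=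
  if i is j.+1 then (krylov j + <[iter j X w]>)%VS else 0%VS.

Lemma krylov_sub i j : (i <= j)%N -> (krylov i <= krylov j)%VS.
Proof.
elim: j => [|j IH]; first by rewrite leqn0 => /eqP ->.
rewrite leq_eqVlt => /predU1P [-> //| /IH h].
exact: subv_trans h (addvSl _ _).
Qed.

Lemma mem_krylov i j : (i < j)%N -> iter i X w \in krylov j.
Proof.
by move=> h; apply: (subvP (krylov_sub _ _ h)); apply: (subvP (addvSr _ _));
  apply: memv_line.
Qed.

Lemma krylov_lfun i u : u \in krylov i -> X u \in krylov i.+1.
Proof.
elim: i u => [u|i IH u]; first by rewrite memv0 => /eqP ->; rewrite linear0 mem0v.
case/memv_addP => u1 /IH h1 [_ /vlineP [c ->] ->].
rewrite linearD linearZ /=; apply: memvD.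
  exact: (subvP (addvSl _ _)).
by apply: memvZ; apply: (subvP (addvSr _ _)); apply: memv_line.
Qed.

(** If every iterate were outside the span of the earlier ones, the dimensions would grow past that
    of [V]. The least index of a dependent iterate is positive since [w != 0]; [m] is its
    predecessor. *)
Lemma krylov_stationary : w != 0 ->
  exists m, iter m X w \notin krylov m /\ iter m.+1 X w \in krylov m.+1.
Proof.
move=> w0.
have ex : exists n, iter n X w \in krylov n.
  apply: NNPP => H.
  have dimE n : (n <= \dim (krylov n))%N.
    elim: n => // n IH; apply: leq_ltn_trans IH _ => /=.
    rewrite (ltn_leqif (dimv_leqif_sup (addvSl _ _))) subv_add subvv /=.
    by apply/negP => h; apply: H; exists n; rewrite memvE.
  by have := leq_trans (dimE _) (dimvS (subvf (krylov (\dim {:V}).+1)));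
    rewrite ltnn.
case: (ex_minnP ex) => [[|m]] h minm; first by move: h; rewrite memv0 (negPf w0).
by exists m; split=> //; apply/negP => /minm; rewrite ltnn.
Qed.

End Krylov.

Arguments krylov_sub {k V X w i j}.

(* On [w], [X w], [X^2 w], ... each [Y] in [A] is triangular, and modulo the
   first [i] of these vectors
   [(Y - lam Y) X^(i+1) w = - (i+1) lam [X, Y] X^i w]. At the first linear
   dependency this forces [(m+1) lam [X, Y] = 0]. *)
Lemma weight_lfun_comm (k : fieldType) (char0 : [pchar k] =i pred0)
    (V : vectType k) (X : 'End(V)) (A : {vspace 'End(V)}) (lam : 'End(V) -> k)
    (w : V) :
  w != 0 -> (forall Y, Y \in A -> lfun_comm X Y \in A) ->
  (forall Y, Y \in A -> Y w = lam Y *: w) ->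
  forall Y, Y \in A -> lam (lfun_comm X Y) = 0.
Proof.
move=> w0 XA Aw.
pose v i := iter i X w; pose U := krylov k V X w.
have commXY (Y : 'End(V)) u : Y (X u) = X (Y u) - lfun_comm X Y u.
  by rewrite lfun_commE opprB addrC subrK.
have UX i u : u \in U i -> X u \in U i.+1 by apply: krylov_lfun.
have Uv i : v i \in U i.+1 by apply: mem_krylov.
have USS i u : u \in U i -> u \in U i.+1.
  by apply: (subvP (krylov_sub _)).
(* Both claims are proved for all [Y] in [A] at once, because the induction step also uses them for
   [[X, Y]]. *)
have triang i Y : Y \in A ->
    Y (v i) - lam Y *: v i \in U i /\
    Y (v i.+1) - lam Y *: v i.+1 + (lam (lfun_comm X Y) *+ i.+1) *: v i \in U i.
  elim: i Y => [|i IH] Y YA.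
    rewrite /v /=; split; first by rewrite (Aw Y YA) subrr mem0v.
    rewrite commXY (Aw Y YA) (Aw _ (XA _ YA)) [X (_ *: _)]linearZ /= mulr1n.
    by rewrite addrAC subrK subrr mem0v.
  have [_ hY] := IH _ YA; have [hZ0 hZ] := IH _ (XA _ YA).
  set c := lam (lfun_comm X Y) in hY hZ *; split.
    rewrite -[X in X \in _](addrK ((c *+ i.+1) *: v i)).
    by apply: memvB; [apply: USS | apply/memvZ/Uv].
  have {}hZ : lfun_comm X Y (v i.+1) - c *: v i.+1 \in U i.+1.
    rewrite -[X in X \in _](addrK ((lam (lfun_comm X (lfun_comm X Y)) *+ i.+1) *: v i)).
    by apply: memvB; [apply: USS | apply/memvZ/Uv].
  (* Apply [X] to [hY], subtract [hZ] and use [Y X = X Y - [X, Y]]: the coefficient [(i+1) c]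
     becomes [(i+2) c]. *)
  have := memvB (UX _ _ hY) hZ.
  rewrite linearD linearB /= ![X (_ *: _)]linearZ /=.
  have rearr (p q z d e : V) : p - q + e - (z - d) = p - z - q + (d + e).
    by rewrite addrAC opprB [d - z]addrC !addrA [p - q - z]addrAC.
  by rewrite rearr -scalerDl -mulrS -commXY.
have [m [vm vSm]] := krylov_stationary k V X w w0.
have lower Y u : Y \in A -> u \in U m.+1 -> Y u - lam Y *: u \in U m.
  move=> YA; have: (m.+1 <= m.+1)%N by [].
  elim: {1 3}m.+1 u => [u _|i IH u lei].
    by rewrite memv0 => /eqP ->; rewrite linear0 scaler0 subrr mem0v.
  case/memv_addP => u1 /(IH _ (ltnW lei)) h1 [_ /vlineP [c ->] ->].
  rewrite linearD linearZ /= scalerDr opprD addrACA; apply: memvD => //.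
  rewrite scalerA mulrC -scalerA -scalerBr; apply: memvZ.
  by apply: (subvP (krylov_sub (j := m) (i := i) _)); [ | case: (triang i Y YA)].
move=> Y YA; have [_ h] := triang m Y YA.
(* By the choice of [m], [v m.+1] lies in [U m.+1], so [lower] puts [(Y - lam Y) (v m.+1)] in [U m].
   What remains is a multiple of [v m] in [U m], whose coefficient must vanish. *)
have {h} := memvB h (lower _ _ YA vSm).
rewrite addrAC subrr add0r => h.
apply/eqP; apply: contraR vm => c0.
have c0' : lam (lfun_comm X Y) *+ m.+1 != 0.
  by rewrite -mulr_natr mulf_neq0 // (pcharf0P _).1.
by rewrite -[iter m X w](scalerK c0'); apply: memvZ.
Qed.

(** * Lie's theorem for lists of endomorphisms *)

Lemma line_coordK (k : fieldType) (V : vectType k) (v u : V) :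
  u \in <[v]>%VS -> u = coord [tuple v] ord0 u *: v.
Proof.
rewrite -span_seq1 => uv.
by rewrite {1}(coord_span (X := [tuple v]) uv) big_ord1.
Qed.

Lemma memv_bigcap_seqP (k : fieldType) (V : vectType k) (I : eqType)
    (s : seq I) (F : I -> {vspace V}) (v : V) :
  reflect (forall i, i \in s -> v \in F i) (v \in (\bigcap_(i <- s) F i)%VS).
Proof.
elim: s => [|i s IH]; first by rewrite big_nil memvf; apply: ReflectT.
rewrite big_cons; apply: (iffP memv_capP) => [[vi /IH vs] j|vs].
  by rewrite inE => /predU1P [-> //|/vs].
split; first by apply: vs; rewrite inE eqxx.
by apply/IH => j js; apply: vs; rewrite inE js orbT.
Qed.

(* Solvability in list form: each tail spans an ideal of the Lie algebra spanned
   by the next longer tail. *)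
Fixpoint polycyclic (k : fieldType) (V : vectType k) (s : seq 'End(V)) : Prop :=
  if s is X :: t then
    (forall Y, Y \in t -> lfun_comm X Y \in <<t>>%VS) /\ polycyclic k V t
  else True.

Arguments polycyclic {k V}.

(** All commutators of [s] with [s ++ t] already land in the span of [t], which lies in the span of
    every longer tail; hence the order inside [s] is irrelevant. *)
Lemma polycyclic_cat (k : fieldType) (V : vectType k) (s t : seq 'End(V)) :
  (forall X Y, X \in s -> Y \in s ++ t -> lfun_comm X Y \in <<t>>%VS) ->
  polycyclic t -> polycyclic (s ++ t).
Proof.
move=> + pt; elim: s => //= X s IH st; split=> [Y Yst|].
  rewrite span_cat; apply: (subvP (addvSr _ _)).
  by apply: st; rewrite inE ?eqxx // Yst orbT.
by apply: IH => Z Y Zs Yst; apply: st; rewrite inE ?Zs ?Yst orbT.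
Qed.

Lemma lfun_comm_is_linear (k : fieldType) (V : vectType k) (X : 'End(V)) :
  linear (lfun_comm X).
Proof.
move=> c Y Z; apply/lfunP => u.
rewrite !(lfun_commE, add_lfunE, scale_lfunE) linearD linearZ /=.
by rewrite scalerBr opprD addrACA.
Qed.

HB.instance Definition _ (k : fieldType) (V : vectType k) (X : 'End(V)) :=
  GRing.isLinear.Build k 'End(V) 'End(V) _ (lfun_comm X)
    (lfun_comm_is_linear k V X).

Lemma linear_span (k : fieldType) (V U : vectType k) (F : {linear V -> U})
    (s : seq V) (W : {vspace U}) :
  (forall x, x \in s -> F x \in W) -> forall x, x \in <<s>>%VS -> F x \in W.
Proof.
move=> sW x; rewrite -lfunE memv_preim; apply/subvP/span_subvP => y ys.
by rewrite -memv_preim lfunE; apply: sW.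
Qed.

(** Evaluation at [v] is named so that it can carry a linear structure and [linear_span] applies to
    it. *)
Definition evalv (k : fieldType) (V : vectType k) (v : V) (X : 'End(V)) := X v.

Lemma evalv_is_linear (k : fieldType) (V : vectType k) (v : V) :
  linear (evalv k V v).
Proof. by move=> c X Y; rewrite /evalv add_lfunE scale_lfunE. Qed.

HB.instance Definition _ (k : fieldType) (V : vectType k) (v : V) :=
  GRing.isLinear.Build k 'End(V) V _ (evalv k V v) (evalv_is_linear k V v).

(** Induction on the list: an eigenvector of the tail defines a weight [lam], whose weight space
    [W'] in [W] is nonzero. It is stable under [X] because [lam] kills commutators with [X], so [X]
    has an eigenvector in it. *)
Theorem lie_theorem (k : closedFieldType) (char0 : [pchar k] =i pred0)
    (V : vectType k) (s : seq 'End(V)) (W : {vspace V}) :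
  polycyclic s -> W != 0%VS ->
  (forall X w, X \in s -> w \in W -> X w \in W) ->
  exists v, [/\ v \in W, v != 0 & forall X, X \in <<s>>%VS -> X v \in <[v]>%VS].
Proof.
move=> + W0; elim: s => [_ _|X s IH [Xs ps] sW].
  exists (vpick W); rewrite memv_pick vpick0; split=> // X.
  by rewrite span_nil memv0 => /eqP ->; rewrite zero_lfunE mem0v.
have [|v [vW v0 sv]] := IH ps.
  by move=> Y w Ys; apply: sW; rewrite inE Ys orbT.
pose lam (Y : 'End(V)) := coord [tuple v] ord0 (Y v).
have lamv Y : Y \in <<s>>%VS -> Y v = lam Y *: v by move/sv/line_coordK.
have XA : forall Y, Y \in <<s>>%VS -> lfun_comm X Y \in <<s>>%VS.
  exact: linear_span.
have lam0 := weight_lfun_comm k char0 V X _ lam v v0 XA lamv.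
pose W' := (W :&: \bigcap_(Y <- s) lker (Y - lam Y *: \1%VF))%VS.
have W'P w : reflect (w \in W /\ forall Y, Y \in s -> Y w = lam Y *: w) (w \in W').
  apply: (iffP memv_capP) => -[wW].
    move=> /memv_bigcap_seqP H; split=> // Y /H /eqlfunP ->.
    by rewrite scale_lfunE id_lfunE.
  move=> H; split=> //; apply/memv_bigcap_seqP => Y Ys.
  by apply/eqlfunP; rewrite H // scale_lfunE id_lfunE.
have W's w : w \in W' -> forall Y, Y \in <<s>>%VS -> Y w = lam Y *: w.
  case/W'P => _ wY Y.
  rewrite -[Y w]/(evalv k V w Y) => Ys.
  apply/eqP; rewrite -subr_eq0 -memv0; move: Y Ys.
  (* [F Y] is [Y w - lam Y *: w]; it is linear in [Y], so vanishing on the list [s] extends to its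
     span. *)
  pose F (Y : 'End(V)) := evalv k V w Y - coord [tuple v] ord0 (evalv k V v Y) *: w.
  have Flin : linear F.
    move=> c Y Z; rewrite /F !linearP /= scalerDl -scalerA scalerBr.
    by rewrite opprD addrACA.
  pose Fl := GRing.isLinear.Build k 'End(V) V _ F Flin.
  pose FL : {linear 'End(V) -> V} := HB.pack F Fl.
  apply: (linear_span _ _ _ FL) => Y Ys.
  by rewrite memv0 subr_eq0; apply/eqP/wY.
have W'0 : W' != 0%VS.
  apply: contraNneq v0 => W'0; rewrite -memv0 -W'0.
  by apply/W'P; split=> // Y Ys; apply/lamv/memv_span.
have [|u /andP [uW' u0] Xu] := lfun_eigenvector k V X W' W'0.
  move=> w wW'; have [wW _] := W'P _ wW'.
  apply/W'P; split=> [|Y Ys]; first by apply: sW; rewrite ?inE ?eqxx.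
  have YA := memv_span Ys.
  (* Here [[X, Y] w = lam [X, Y] *: w = 0], so [Y (X w) = X (Y w) = lam Y *: X w]. *)
  have /eqP := lfun_commE k V X Y w.
  rewrite (W's _ wW' _ (XA _ YA)) (lam0 _ YA) scale0r eq_sym subr_eq0 => /eqP <-.
  by rewrite (W's _ wW' _ YA) linearZ.
exists u; split=> //; first by case/W'P: uW'.
apply: (linear_span _ _ _ (evalv k V u)) => Y; rewrite inE => /predU1P [-> //|Ys].
by rewrite /= /evalv (W's _ uW' _ (memv_span Ys)) memvZ ?memv_line.
Qed.

(** * From the derived series to a polycyclic list *)

(** Otherwise any list of elements of [P] could be extended by one outside its span, giving spans of
    arbitrarily large dimension. This replaces families indexed by the possibly infinite [S] by
    finite lists. *)
Lemma ex_spanning_seq (k : fieldType) (V : vectType k) (P : V -> Prop) :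
  exists s : seq V,
    (forall x, x \in s -> P x) /\ (forall x, P x -> x \in <<s>>%VS).
Proof.
apply: NNPP => H.
suff /(_ (\dim {:V}).+1) [s _] : forall n,
    exists2 s : seq V, forall x, x \in s -> P x & (n <= \dim <<s>>)%N.
  by rewrite ltnNge dimvS ?subvf.
elim=> [|n [s sP ns]]; first by exists [::].
have [x Px xs] : exists2 x, P x & x \notin <<s>>%VS.
  apply: NNPP => H'; apply: H; exists s; split=> // x Px.
  by apply: contraT => xs; case: H'; exists x.
exists (x :: s) => [y|]; first by rewrite inE => /predU1P [-> //|/sP].
apply: leq_ltn_trans ns _; rewrite span_cons.
by rewrite (ltn_leqif (dimv_leqif_sup (addvSr _ _))) subv_add subvv andbT -memvE.
Qed.

Section SolvableAction.

Variables (k : fieldType) (S : Type) (L V : vectType k).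
Variables (br : S -> {bilinear L -> L -> L}) (f : S -> {linear L -> 'End(V)}).
Hypothesis f_br : forall x y h i,
  f h (br i x y) = lfun_comm (f h x) (f i y).

Lemma derived_bracket n x y i :
  derived br n.+1 x -> derived br n.+1 y -> derived br n.+2 (br i x y).
Proof.
move=> Dx Dy; exists [:: br i x y]; split; last by rewrite big_seq1.
move=> _ /[!inE] /eqP ->; exists i, [:: br i x y]; rewrite memv_span1.
by split=> // _ /[!inE] /eqP ->; exists x, y.
Qed.

Lemma derivedS n x : derived br n.+2 x -> derived br n.+1 x.
Proof.
elim: n x => [//|n IH] x [s [sP ->]]; exists s; split=> // y /sP [i [t [tP yt]]].
exists i, t; split=> // z /tP [a [b [Da Db ->]]].
by exists a, b; split=> //; apply: IH.
Qed.

(** Each term of the derived series contributes a finite list spanning its image under all the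
    [f i], and these lists are concatenated. By [f_br], commutators from one term land in the image
    of the next, even across different indices. *)
Lemma solvable_polycyclic : lie_like2_solvable br ->
  exists s : seq 'End(V), [/\ polycyclic s,
    forall X, X \in s -> exists i x, X = f i x
    & forall i x, f i x \in <<s>>%VS].
Proof.
case=> -[//|N] _ D0.
(* Induction on [m], the number of steps from term [n.+1] of the series down to a zero term. *)
suff /(_ N 0%N D0) [s [ps sf fs]] : forall m n,
    (forall x, derived br (n + m).+1 x -> x = 0) ->
    exists s : seq 'End(V), [/\ polycyclic s,
      forall X, X \in s -> exists i x, derived br n.+1 x /\ X = f i x
      & forall i x, derived br n.+1 x -> f i x \in <<s>>%VS].
  exists s; split=> // [X /sf [i [x [_ ->]]]|i x]; [by exists i, x | exact: fs].
elim=> [|m IH] n Dn.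
  exists [::]; split=> // i x; rewrite -(addn0 n) => /Dn ->.
  by rewrite linear0 mem0v.
have [|t [pt tf ft]] := IH n.+1; first by rewrite addSnnS.
have [s [sf fs]] := ex_spanning_seq k _
  (fun X => exists i x, derived br n.+1 x /\ X = f i x).
have stf X : X \in s ++ t -> exists i x, derived br n.+1 x /\ X = f i x.
  rewrite mem_cat => /orP [/sf //|/tf [i [x [Dx ->]]]].
  by exists i, x; split=> //; apply: derivedS.
exists (s ++ t); split=> // [|i x Dx]; last first.
  by rewrite span_cat; apply: (subvP (addvSl _ _)); apply: fs; exists i, x.
apply: polycyclic_cat pt => X Y /sf [h [x [Dx ->]]] /stf [i [y [Dy ->]]].
by rewrite -f_br; apply: ft; apply: derived_bracket.
Qed.

End SolvableAction.

(** * Weights as linear functionals, and the two cases for the module *)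

(** Taking the eigenvalue as a coordinate along [v] makes it linear in [z] by construction. *)
Definition line_weight (k : fieldType) (L V : vectType k) (v : V)
    (F : {linear L -> 'End(V)}) (z : L) : k :=
  coord [tuple v] ord0 (F z v).

Lemma line_weight_is_scalar (k : fieldType) (L V : vectType k) (v : V)
    (F : {linear L -> 'End(V)}) :
  scalar (line_weight k L V v F).
Proof.
by move=> c x y; rewrite /line_weight linearP add_lfunE scale_lfunE linearP.
Qed.

HB.instance Definition _ (k : fieldType) (L V : vectType k) (v : V)
    (F : {linear L -> 'End(V)}) :=
  GRing.isLinear.Build k L k *%R (line_weight k L V v F)
    (line_weight_is_scalar k L V v F).

Theorem proposition2p4 (k : closedFieldType) (char0 : [pchar k] =i pred0)
    (S : Type) (S_nonempty : inhabited S)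
    (L : vectType k) (br : S -> {bilinear L -> L -> L})
    (L_lie_like2 : lie_like2 br) (L_solvable : lie_like2_solvable br)
    (V : vectType k) (V_neq0 : ({:V} != 0)%VS)
    (f g : S -> {linear L -> 'End(V)}) (V_module : ordinary_module br f g) :
  exists (phi psi : S -> {scalar L}) (v : V),
    [/\ v != 0,
        forall (z : L) (i : S), f i z v = phi i z *: v /\ g i z v = psi i z *: v
      & (forall (i : S) (z : L), psi i z = 0)
        \/ (forall (i : S) (z : L), phi i z = psi i z)].
Proof.
have f_br x y h i : f h (br i x y) = lfun_comm (f h x) (f i y).
  by have [[]] := V_module x y h i.
have [s [ps sf fs]] := solvable_polycyclic k S L V br f f_br L_solvable.
suff [v v0 fgv] : exists2 v, v != 0 & (forall i z, f i z v \in <[v]>%VS) /\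
    ((forall i z, g i z v = 0) \/ (forall i z, g i z v = f i z v)).
  exists (fun i => line_weight k L V v (f i)).
  exists (fun i => line_weight k L V v (g i)), v.
  case: fgv => fv gv; split=> // [z i|]; last first.
    case: gv => gv; [left | right] => i z; rewrite /= /line_weight gv //.
    exact: linear0.
  split; apply: line_coordK; first exact: fv.
  by case: gv => ->; rewrite ?mem0v.
have [t [tg gt]] := ex_spanning_seq k 'End(V) (fun X => exists i x, X = g i x).
pose K := (\bigcap_(X <- t) lker X)%VS.
have KP v : v \in K <-> forall i x, g i x v = 0.
  split=> [/memv_bigcap_seqP H i x|H].
    apply/eqP; rewrite -memv0.
    apply: (linear_span _ _ _ (evalv k V v) t) => [X /H|].
      by rewrite memv_ker memv0.
    by apply: gt; exists i, x.
  apply/memv_bigcap_seqP => X /tg [i [x ->]].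
  by rewrite memv_ker H.
have [K0|K0] := eqVneq K 0%VS.
  have gf i z v : g i z v = f i z v.
    (* The module identities give [g_j(x) g_i(z) = g_j(x) f_i(z)], so the difference
       [g_i(z) v - f_i(z) v] lies in [K = 0]. *)
    apply/eqP; rewrite -subr_eq0 -memv0 -K0; apply/KP => j x.
    have [_ gg gf _ _] := V_module x z i j.
    rewrite linearB /= -!comp_lfunE.
    have -> : (g j x \o g i z = g j x \o f i z)%VF by rewrite gg gf.
    by rewrite subrr.
  have [|v [_ v0 sv]] := lie_theorem k char0 V s {:V} ps V_neq0.
    by move=> *; apply: memvf.
  by exists v => //; split=> [i z|]; [apply: sv | right].
have [|v [vK v0 sv]] := lie_theorem k char0 V s K ps K0.
  (* [K] is invariant: [g_h(x) f_i(y) v = g_h(x) g_i(y) v = 0] for [v] in [K]. *)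
  move=> _ v /sf [i [y ->]] /KP gv; apply/KP => h x.
  have [_ gg gf _ _] := V_module x y i h.
  by rewrite -comp_lfunE -gf -gg comp_lfunE gv linear0.
exists v => //; split=> [i z|]; first exact: sv.
by left; apply/KP.
Qed.
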